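(* Let $p(n)$ denote the number of partitions of $n$, i.e. $\prod_{k=1}^{\infty}\frac{1}{1-t^k}=\sum_{n\ge0}p(n)t^n$ as formal power series. Then $p(0)=1$ and for every integer $n\ge1$, $$p(n)=\sum_{(k_1,\dots,k_n)\in\pi(n)}\prod_{j=1}^{n}\left[\frac{1}{k_j!}\left(\frac{\sigma(j)}{j}\right)^{k_j}\right].$$
   Context: The set $\mathbb{N}$ contains $0$. For $n\ge1$, $\pi(n)=\{(k_1,\dots,k_n)\in\mathbb{N}^n : k_1+2k_2+\cdots+nk_n=n\}$. For $j\ge1$, $\sigma(j)=\sum_{i\mid j} i$ is the sum of the positive divisors of $j$. *)

(* Defs.v *)
From mathcomp Require Import all_boot all_order all_algebra.

Set Implicit Arguments.
Unset Strict Implicit.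
Unset Printing Implicit Defensive.

Import Order.TTheory GRing.Theory Num.Theory.

Definition is_partition_of (n : nat) (s : seq nat) : bool :=
  [&& sorted geq s, 0 \notin s & sumn s == n].

(* A partition of [n] has at most [n] parts, each at most [n]; hence the
   finite type [n.-bseq 'I_n.+1] already contains all of them (see
   [partition_bseq] below). *)
Definition npartitions (n : nat) : nat :=
  #|[set s : n.-bseq 'I_n.+1 | is_partition_of n (map val s)]|.

Definition sigma (j : nat) : nat := \sum_(d <- divisors j) d.

(* [k i] is the component k_(i+1), because ['I_n] starts at 0.  The bound
   [k i <= n] is implied by the equation (see [pi_tuples_ffun] below). *)
Definition pi_tuples (n : nat) : {set {ffun 'I_n -> 'I_n.+1}} :=
  [set k : {ffun 'I_n -> 'I_n.+1} | \sum_(i < n) i.+1 * k i == n].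

Lemma partition_bseq (n : nat) (s : seq nat) :
  is_partition_of n s -> exists t : n.-bseq 'I_n.+1, map val t = s.
Proof.
case/and3P=> _ s0 /eqP sn.
have les : all (fun x => x < n.+1) s.
  apply/allP=> x xs; rewrite ltnS -sn sumnE (big_rem x xs) /=.
  exact: leq_addr.
have szs : size s <= n.
  rewrite -sn sumnE -sum1_size big_seq [leqRHS]big_seq.
  apply: leq_sum => x xs; rewrite lt0n; apply: contraNneq s0 => <- //.
have mapK : map val (map (@inord n) s) = s.
  rewrite -map_comp; apply: map_id_in => x /(allP les) xn /=.
  by rewrite inordK.
have szt : size (map (@inord n) s) <= n by rewrite size_map.
by exists (Bseq szt).
Qed.

Lemma pi_tuples_ffun (n : nat) (k : 'I_n -> nat) :
  \sum_(i < n) i.+1 * k i = n ->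
  exists2 l, l \in pi_tuples n & forall i, l i = k i :> nat.
Proof.
move=> kn.
have lek i : k i < n.+1.
  rewrite ltnS -[leqRHS]kn (bigD1 i) //=.
  by apply: leq_trans (leq_addr _ _); rewrite mulSn leq_addr.
exists [ffun i => Ordinal (lek i)] => [|i]; last by rewrite ffunE.
by rewrite inE -[X in _ == X]kn; apply/eqP/eq_bigr => i _; rewrite ffunE.
Qed.

Local Open Scope ring_scope.

(* A formal power series is its sequence of coefficients. *)
Definition fps (R : Type) : Type := nat -> R.

Definition fps_one (R : comUnitRingType) : fps R := fun n => (n == 0%N)%:R.

Definition fps_Xn (R : comUnitRingType) (k : nat) : fps R :=
  fun n => (n == k)%:R.

Definition fps_sub (R : comUnitRingType) (f g : fps R) : fps R :=
  fun n => f n - g n.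

Definition fps_mul (R : comUnitRingType) (f g : fps R) : fps R :=
  fun n => \sum_(i < n.+1) f i * g (n - i)%N.

(* First [n] coefficients of [1 / f], obtained by solving [f * g = 1] degree
   by degree; see [fps_mulfV]. *)
Fixpoint fps_inv_seq (R : comUnitRingType) (f : fps R) (n : nat) : seq R :=
  if n is m.+1 then
    let s := fps_inv_seq f m in
    rcons s ((f 0%N)^-1 *
             ((m == 0%N)%:R - \sum_(i < m) f (m - i)%N * nth 0 s i))
  else [::].

Definition fps_inv (R : comUnitRingType) (f : fps R) : fps R :=
  fun n => nth 0 (fps_inv_seq f n.+1) n.

Lemma size_fps_inv_seq (R : comUnitRingType) (f : fps R) (n : nat) :
  size (fps_inv_seq f n) = n.
Proof. by elim: n => //= n IHn; rewrite size_rcons IHn. Qed.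

Lemma nth_fps_inv_seq (R : comUnitRingType) (f : fps R) (n i : nat) :
  (i < n)%N -> nth 0 (fps_inv_seq f n) i = fps_inv f i.
Proof.
elim: n => // n IHn; rewrite ltnS leq_eqVlt => /predU1P[-> // | lt_in].
by rewrite /= nth_rcons size_fps_inv_seq lt_in IHn.
Qed.

Lemma fps_mulfV (R : comUnitRingType) (f : fps R) :
  f 0%N \is a GRing.unit -> fps_mul f (fps_inv f) =1 fps_one R.
Proof.
move=> f0 n; rewrite /fps_mul (reindex_inj rev_ord_inj) /= big_ord_recr /=.
rewrite subSS subnn subn0 {2}/fps_inv /= nth_rcons size_fps_inv_seq.
rewrite ltnn eqxx mulrA divrr // mul1r addrC -addrA -[RHS]addr0; congr (_ + _).
apply/eqP; rewrite addrC subr_eq0; apply/eqP/eq_bigr => i _.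
rewrite !subSS nth_fps_inv_seq // subKn //; exact: ltnW.
Qed.

(* [\prod_(k >= 1) F k = S]: convergence in the usual topology of formal power
   series, i.e. each coefficient of the partial products is eventually equal
   to that of [S]. *)
Definition fps_infprod (R : comUnitRingType) (F : nat -> fps R) (S : fps R) :
    Prop :=
  forall n : nat, exists N : nat, forall M : nat, (N <= M)%N ->
    (\big[@fps_mul R/fps_one R]_(1 <= k < M.+1) F k) n = S n.

(* Main.v *)
Require Import Defs.
From mathcomp Require Import all_boot all_order all_algebra.
From mathcomp Require Import ring.

Set Implicit Arguments.
Unset Strict Implicit.
Unset Printing Implicit Defensive.

Import Order.TTheory GRing.Theory Num.Theory.
Local Open Scope ring_scope.

(** Taking logarithms in Euler's product, the sum over [k] of
    [- log (1 - t^k) = \sum_m t^(k m) / m] has [sigma j / j] as its coefficient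
    of degree [j], so that [\prod_k 1 / (1 - t^k)] equals
    [\prod_j exp (sigma j / j * t^j)].  Expanding the exponentials and reading
    off the coefficient of [t^n] gives the sum over [pi_tuples n], while
    expanding the geometric series counts the elements of [pi_tuples n], that
    is, the partitions of [n] described by the multiplicities of their parts
    ([npartitions_pi_tuples]).  Both expansions are [coef_prod_pi_tuples].

    To compare the two products without logarithms, fix [n] and truncate all
    series to polynomials, equality being understood up to some degree
    ([eq_upto]).  In characteristic 0 a series is determined by its constant
    term and its logarithmic derivative ([logderiv_uniq]), and logarithmic
    derivatives turn products into sums ([logderiv_prod]).  The factor
    [exp (sigma j / j * t^j)] contributes [sigma j * t^(j - 1)], the factor
    [1 / (1 - t^k)] contributes [k t^(k - 1) / (1 - t^k)], and the sum of the
    latter over [k] collects in degree [j - 1] the divisors [k] of [j]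
    ([sum_sigmaX]).

    For the infinite product, the coefficients of [1 / (1 - t^k)] are computed
    from the recursion defining the inverse ([fps_inv_geom]), and the factors
    with [k > n] do not affect the degrees up to [n] ([prod_geomX_stable]).

    Indices [j] of the factors start at 0, so that factor [j] is a series in
    ['X^(j.+1)]. *)

(** * Partitions and multiplicities *)

Lemma sumn_count n (s : seq nat) : 0%N \notin s -> all (leq^~ n) s ->
  sumn s = (\sum_(i < n) i.+1 * count_mem i.+1 s)%N.
Proof.
move=> s0 /allP sn; rewrite sumnE.
under [RHS]eq_bigr => i _ do rewrite -sum1_count big_distrr big_mkcond /=.
rewrite exchange_big /= big_seq [RHS]big_seq; apply: eq_bigr => x xs.
have x0 : (0 < x)%N by rewrite lt0n; apply: contraNneq s0 => <-.
have xn : (x.-1 < n)%N by rewrite prednK // sn.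
rewrite (bigD1 (Ordinal xn)) //= prednK // eqxx muln1 big1 ?addn0 // => i.
rewrite -val_eqE /= => ix; case: eqP => [xi|_]; last by [].
by rewrite xi eqxx in ix.
Qed.

Lemma parts_bounded n s : is_partition_of n s -> all (leq^~ n) s.
Proof.
case/and3P=> _ _ /eqP <-; apply/allP => x xs.
by rewrite sumnE (big_rem x xs) leq_addr.
Qed.

Definition multiplicities n (s : n.-bseq 'I_n.+1) : {ffun 'I_n -> 'I_n.+1} :=
  [ffun i => inord (count_mem (val i).+1 (map val s))].

Lemma multiplicitiesE n (s : n.-bseq 'I_n.+1) i :
  multiplicities s i = count_mem i.+1 (map val s) :> nat.
Proof.
rewrite ffunE inordK // ltnS; apply: leq_trans (count_size _ _) _.
by rewrite size_map size_bseq.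
Qed.

(** A partition is the same thing as the family of multiplicities of its parts:
    a sorted sequence is determined by these counts, and any family of counts
    is realised by sorting the sequence made of that many copies of each
    part. *)
Lemma npartitions_pi_tuples n : npartitions n = #|pi_tuples n|.
Proof.
rewrite /npartitions -(card_in_imset (f := @multiplicities n)).
  apply: eq_card => k; apply/imsetP/idP => [[s] | ].
    rewrite inE => ps -> ; rewrite inE; have [_ s0 /eqP sn] := and3P ps.
    rewrite -[X in _ == X]sn (sumn_count s0 (parts_bounded ps)).
    by apply/eqP/eq_bigr => i _; rewrite multiplicitiesE.
  rewrite inE => /eqP kn.
  pose s := flatten [seq nseq (k i) i.+1 | i <- enum 'I_n].
  have cs (i : 'I_n) : count_mem i.+1 s = k i.
    rewrite count_flatten -map_comp sumnE big_map big_enum /= (bigD1 i) //=.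
    rewrite count_nseq /= eqxx mul1n big1 ?addn0 // => j.
    by rewrite count_nseq /= eqSS -val_eqE => /negbTE->.
  have s_range x : x \in s -> (0 < x <= n)%N.
    by case/flatten_mapP => i _ /nseqP[-> _] /=.
  have ps : is_partition_of n (sort geq s).
    apply/and3P; split; first by apply: sort_sorted => x y; apply: leq_total.
      by rewrite mem_sort; apply/negP => /s_range.
    rewrite (perm_sumn (permEl (perm_sort _ _))) -[X in _ == X]kn (@sumn_count n).
    - by apply/eqP/eq_bigr => i _; rewrite cs.
    - by apply/negP => /s_range.
    - by apply/allP => x /s_range/andP[].
  have [t tE] := partition_bseq ps.
  exists t; first by rewrite inE tE.
  apply/ffunP => i; apply: ord_inj; rewrite multiplicitiesE tE -cs.
  exact/esym/permP/permEl/perm_sort.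
(* Injectivity: two sorted sequences that are permutations of each other agree. *)
move=> s t; rewrite !inE => ps pt st; apply/val_inj/(inj_map val_inj).
have [ss s0 _] := and3P ps; have [tt t0 _] := and3P pt.
apply: (sorted_eq _ _ ss tt) => [y x z xy yz|x y /andP[]|].
- exact: leq_trans yz xy.
- by move=> xy yx; apply/eqP; rewrite eqn_leq; apply/andP.
apply/allP => x _ /=; case: (posnP x) => [-> | x0].
  by rewrite !(count_memPn _).
case: (leqP x n) => [xn|nx]; last first.
  have out r : is_partition_of n r -> x \notin r.
    by move/parts_bounded/allP=> rn; apply/negP => /rn; rewrite leqNgt nx.
  by rewrite !(count_memPn _) ?out.
have xn' : (x.-1 < n)%N by rewrite prednK.
have := congr1 (fun k : {ffun 'I_n -> 'I_n.+1} => k (Ordinal xn') : nat) st.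
by rewrite !multiplicitiesE /= prednK // => ->.
Qed.

(** * Polynomials up to a given degree *)

(** Congruence modulo ['X^n]. *)
Definition eq_upto (R : nzRingType) n (p q : {poly R}) :=
  forall i, (i < n)%N -> p`_i = q`_i.

Lemma eq_upto_mul (R : nzRingType) n (p p' q q' : {poly R}) :
  eq_upto n p p' -> eq_upto n q q' -> eq_upto n (p * q) (p' * q').
Proof.
move=> pp qq i lt_in; rewrite !coefM; apply: eq_bigr => j _.
rewrite pp ?qq // ?(leq_ltn_trans (leq_subr _ _)) //.
by apply: leq_ltn_trans lt_in; rewrite -ltnS.
Qed.

Lemma eq_upto_add (R : nzRingType) n (p p' q q' : {poly R}) :
  eq_upto n p p' -> eq_upto n q q' -> eq_upto n (p + q) (p' + q').
Proof. by move=> pp qq i lt_in; rewrite !coefD pp ?qq. Qed.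

Lemma eq_upto_addXn (R : nzRingType) n m (p q r : {poly R}) : (n <= m)%N ->
  q = p + 'X^m * r -> eq_upto n p q.
Proof.
move=> nm -> i lt_in; rewrite coefD coefXnM (leq_trans lt_in nm).
by rewrite addr0.
Qed.

(** [s] is a logarithmic derivative of [p] modulo ['X^n]; the product form
    avoids dividing by [p]. *)
Definition logderiv (R : nzRingType) n (p s : {poly R}) :=
  eq_upto n p^`() (p * s).

Lemma logderiv_prod (R : comNzRingType) n I (r : seq I) (p s : I -> {poly R}) :
  (forall i, logderiv n (p i) (s i)) ->
  logderiv n (\prod_(i <- r) p i) (\sum_(i <- r) s i).
Proof.
move=> ps; apply: (big_ind2 (@logderiv R n)) => // [|p1 s1 p2 s2 h1 h2].
  by rewrite /logderiv -polyC1 derivC mulr0.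
rewrite /logderiv derivM mulrDr.
by apply: eq_upto_add; [rewrite mulrAC|rewrite -mulrA]; apply: eq_upto_mul.
Qed.

(** Degree [i] of [p^`() = p * s] gives [i.+1] times the coefficient [i.+1] of
    [p] in terms of the coefficients of [p] of degree at most [i]; as [i.+1] can
    be cancelled, these are determined one after the other. *)
Lemma logderiv_uniq (R : numDomainType) n (p q s t : {poly R}) :
  logderiv n p s -> logderiv n q t -> eq_upto n s t -> p`_0 = q`_0 ->
  eq_upto n.+1 p q.
Proof.
move=> ps qt st pq0; elim/ltn_ind => -[//|i] IH lt_in.
have h : p^`()`_i = q^`()`_i.
  rewrite ps // qt // !coefM; apply: eq_bigr => -[j /= ji] _.
  rewrite st; last by rewrite (leq_ltn_trans (leq_subr _ _)).
  by rewrite IH // (leq_trans ji) // ltnW.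
by move: h; rewrite !coef_deriv => /(pmulrnI (ltn0Sn i)).
Qed.

(** * Exponential and geometric factors *)

(** The exponential of [a *: 'X^(j.+1)], truncated after [n.+1] terms. *)
Definition expX (R : numFieldType) n (a : R) j : {poly R} :=
  \sum_(m < n.+1) (a ^+ m / m`!%:R) *: 'X^(j.+1 * m).

(** The derivative of a truncated exponential misses exactly the term
    coming from its last summand, of degree [j.+1 * n + j >= n]. *)
Lemma logderiv_expX (R : numFieldType) n (a : R) j :
  logderiv n (expX n a j) ((j.+1%:R * a) *: 'X^j).
Proof.
apply: (@eq_upto_addXn _ _ (j.+1 * n + j) _ _
  (j.+1%:R * a * (a ^+ n / n`!%:R)) %:P).
  by rewrite mulSn -addnA leq_addr.
rewrite [in LHS]/expX big_ord_recr mulrDl /=; congr (_ + _); last first.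
  by rewrite -scalerAl -scalerAr -exprD scalerA mulrC [RHS]mulrC mul_polyC.
rewrite mulr_suml /expX raddf_sum /= big_ord_recl muln0 /=.
rewrite derivZ derivXn mulr0n scaler0 add0r; apply: eq_bigr => m _.
rewrite derivZ derivXn mulnS /= -scalerAl -scalerAr -exprD scalerA.
rewrite addnC -scaler_nat scalerA; congr (_ *: _).
rewrite -mulnS factS !natrM exprS invfM.
have m1 : m.+1%:R != 0 :> R by rewrite pnatr_eq0.
move: (m.+1%:R) m1 (m`!%:R^-1) (j.+1%:R) (a ^+ m) => S S0 x J b.
by field.
Qed.

(** The inverse of [1 - 'X^(j.+1)], truncated after [n.+1] terms. *)
Definition geomX (R : nzRingType) n j : {poly R} :=
  \sum_(m < n.+1) 'X^(j.+1 * m).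

Lemma geomXV (R : comNzRingType) n j :
  (1 - 'X^(j.+1)) * geomX R n j = 1 - 'X^(j.+1 * n.+1).
Proof.
rewrite exprM -opprB -[RHS]opprB [in RHS]subrX1 mulNr; congr (- _); congr (_ * _).
by apply: eq_bigr => m _; rewrite exprM.
Qed.

Lemma coef_geomX (R : nzRingType) n j i : (i <= n)%N ->
  (geomX R n j)`_i = (j.+1 %| i)%:R.
Proof.
move=> le_in; rewrite coef_sum.
under eq_bigr do rewrite coefXn.
case: dvdnP => [[q iq]|nd]; last first.
  by rewrite big1 // => m _; case: eqP => // im; case: nd; exists m; rewrite mulnC.
have qn : (q < n.+1)%N by rewrite ltnS (leq_trans _ le_in) // iq mulnS leq_addr.
rewrite (bigD1 (Ordinal qn)) //= iq mulnC eqxx big1 ?addr0 // => m.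
by rewrite -val_eqE eqn_pmul2l // eq_sym => /negbTE->.
Qed.

(** This is the derivative of the relation [(1 - 'X^(j.+1)) * geomX R n j = 1]
    modulo ['X^(n.+1)], multiplied by [geomX R n j] to cancel
    [1 - 'X^(j.+1)]. *)
Lemma logderiv_geomX (R : comNzRingType) n j :
  logderiv n (geomX R n j) (j.+1%:R *: ('X^j * geomX R n j)).
Proof.
set G := geomX R n j.
have G1 : eq_upto n.+1 ((1 - 'X^(j.+1)) * G) 1.
  apply: (@eq_upto_addXn _ _ (j.+1 * n.+1) _ _ 1); first by rewrite leq_pmull.
  by rewrite geomXV mulr1 subrK.
have dG : eq_upto n (((1 - 'X^(j.+1)) * G)^`()) 0.
  by move=> i lt_in; rewrite coef_deriv G1 // coef1 coef0 /= mul0rn.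
move: dG; rewrite derivM derivB derivXn -polyC1 derivC sub0r mulNr => dG i lt_in.
transitivity (G^`() * ((1 - 'X^(j.+1)) * G))`_i.
  rewrite -[in LHS](mulr1 G^`()); apply: eq_upto_mul (lt_in) => // k lt_kn.
  by rewrite G1 // ltnW // ltnS.
have D : eq_upto n (G^`() * (1 - 'X^(j.+1))) ('X^j *+ j.+1 * G).
  move=> k lt_kn; have := dG k lt_kn; rewrite [G^`() * _]mulrC polyC1.
  by rewrite addrC coefD coefN coef0 => /eqP; rewrite subr_eq0 => /eqP->.
rewrite mulrA (eq_upto_mul D (fun _ _ => erefl _)) //.
by rewrite scaler_nat !mulrnAl mulrnAr [in RHS]mulrC.
Qed.

(** * Expansion of the products *)

Lemma sigma_sum n j : (0 < j <= n)%N ->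
  (\sum_(i < n | i.+1 %| j) i.+1)%N = sigma j.
Proof.
case/andP=> j0 jn; rewrite /sigma.
rewrite -(big_mkord (fun i => (i.+1 %| j)%N) (fun i => i.+1)).
rewrite -(big_add1 _ _ 0 n.+1 (fun d => d %| j)%N id) -big_filter; apply: perm_big.
apply: uniq_perm; rewrite ?filter_uniq ?iota_uniq ?divisors_uniq // => d.
rewrite mem_filter mem_index_iota -dvdn_divisors //; case: (boolP (d %| j)%N) => //= dj.
by rewrite (dvdn_gt0 j0 dj) ltnS (leq_trans (dvdn_leq j0 dj)).
Qed.

(** Expanding the product chooses one summand [k j] in each factor [j], and the
    resulting monomial has degree [\sum_j j.+1 * k j]. *)
Lemma coef_prod_pi_tuples (R : comNzRingType) n (c : 'I_n -> nat -> R) :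
  (\prod_(j < n) \sum_(m < n.+1) c j m *: 'X^(j.+1 * m))`_n =
  \sum_(k in pi_tuples n) \prod_(j < n) c j (k j).
Proof.
rewrite bigA_distr_bigA /= coef_sum [RHS]big_mkcond; apply: eq_bigr => k _.
rewrite scaler_prod -[X in _ *: X](_ : 'X^(\sum_(i < n) i.+1 * k i) = _).
  rewrite coefZ coefXn inE eq_sym; case: eqP; rewrite ?mulr1 ?mulr0 //.
by rewrite (big_morph _ (fun m p => exprD 'X m p) (expr0 _)).
Qed.

(** Among the degrees [i < n], the product of ['X^j] with [geomX R n j] has
    coefficient 1 where [j.+1] divides [i.+1] and 0 elsewhere; weighted by
    [j.+1], these add up to the sum of the divisors of [i.+1]. *)
Lemma sum_sigmaX (R : comNzRingType) n :
  eq_upto n (\sum_(j < n) (sigma j.+1)%:R *: 'X^j : {poly R})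
            (\sum_(j < n) j.+1%:R *: ('X^j * geomX R n j)).
Proof.
move=> i lt_in; rewrite !coef_sum (bigD1 (Ordinal lt_in)) //=.
rewrite coefZ coefXn eqxx mulr1 big1 => [|j]; last first.
  by rewrite -val_eqE /= eq_sym coefZ coefXn => /negbTE->; rewrite mulr0.
rewrite addr0 -(@sigma_sum n) // natr_sum big_mkcond; apply: eq_bigr => j _.
rewrite coefZ coefXnM; case: ltnP => [lt_ij|le_ji].
  by rewrite mulr0 gtnNdvd // ltnS.
rewrite coef_geomX; last by rewrite (leq_trans (leq_subr _ _)) // ltnW.
by rewrite -subSS dvdn_subl //; case: ifP => _; rewrite ?mulr1 ?mulr0.
Qed.

(** With all weights equal to 1, [coef_prod_pi_tuples] counts the elements of
    [pi_tuples n]. *)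
Lemma coef_prod_geomX (R : comNzRingType) n :
  (\prod_(j < n) geomX R n j)`_n = (npartitions n)%:R.
Proof.
rewrite npartitions_pi_tuples -sum1_card natr_sum.
have -> : \prod_(j < n) geomX R n j =
    \prod_(j < n) \sum_(m < n.+1) (1 : R) *: 'X^(j.+1 * m).
  by apply: eq_bigr => j _; apply: eq_bigr => m _; rewrite scale1r.
rewrite (coef_prod_pi_tuples (fun _ _ => 1)); apply: eq_bigr => k _.
exact: big1.
Qed.

Lemma coef_prod_expX (R : numFieldType) n (a : nat -> R) :
  (\prod_(j < n) expX n (a j) j)`_n =
  \sum_(k in pi_tuples n) \prod_(j < n) ((k j)`!%:R^-1 * a j ^+ k j).
Proof.
rewrite (coef_prod_pi_tuples (fun j m => a j ^+ m / m`!%:R)).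
by apply: eq_bigr => k _; apply: eq_bigr => j _; rewrite mulrC.
Qed.

Lemma coef0_prod (R : comNzRingType) n (p : 'I_n -> {poly R}) :
  (forall j, (p j)`_0 = 1) -> (\prod_(j < n) p j)`_0 = 1.
Proof.
move=> p1; apply: (big_ind (fun q : {poly R} => q`_0 = 1)) => //.
  by rewrite coef1.
by move=> q r q1 r1; rewrite coef0M q1 r1 mulr1.
Qed.

(** The core of the identity: both products have constant term 1 and the same
    logarithmic derivative. *)
Lemma prod_expX_geomX (R : numFieldType) n :
  eq_upto n.+1 (\prod_(j < n) expX n ((sigma j.+1)%:R / j.+1%:R : R) j)
               (\prod_(j < n) geomX R n j).
Proof.
apply: logderiv_uniq (@sum_sigmaX R n) _.
- apply: logderiv_prod => j.
  have := logderiv_expX (n := n) ((sigma j.+1)%:R / j.+1%:R : R) j.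
  by rewrite [_ * (_ / _)]mulrC divfK // pnatr_eq0.
- by apply: logderiv_prod => j; apply: logderiv_geomX.
rewrite !coef0_prod // => j; first by rewrite coef_geomX.
rewrite /expX coef_sum big_ord_recl muln0 coefZ expr0 coef1 fact0 divr1 mulr1.
by rewrite big1 ?addr0 // => m _; rewrite coefZ coefXn mulr0.
Qed.

(** * The infinite product *)

(** The inverse satisfies [g n = (n == 0)%:R + g (n - k)], the last term being
    present only if [k <= n]; so does the indicator of the multiples of
    [k]. *)
Lemma fps_inv_geom (R : comUnitRingType) k n : (0 < k)%N ->
  fps_inv (fps_sub (fps_one R) (fps_Xn R k)) n = (k %| n)%:R.
Proof.
move=> k0; elim/ltn_ind: n => n IH; set f := fps_sub _ _.
have f0 : f 0%N \is a GRing.unit.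
  by rewrite /f /fps_sub /fps_one /fps_Xn eq_sym (gtn_eqF k0) subr0 unitr1.
have := fps_mulfV f0 n; rewrite /fps_mul /f {1}/fps_sub /fps_one /fps_Xn.
under eq_bigr => i _ do rewrite mulrBl.
rewrite sumrB big_ord_recl /= mul1r subn0 [in X in _ + X - _]big1 => [|i _]; last first.
  by rewrite mul0r.
rewrite addr0 => /eqP; rewrite subr_eq => /eqP ->.
case: (leqP k n) => [le_kn|lt_nk].
  have lt_kn : (k < n.+1)%N by [].
  rewrite (bigD1 (Ordinal lt_kn)) //= eqxx mul1r big1 => [|i]; last first.
    by rewrite -val_eqE /= => /negbTE->; rewrite mul0r.
  rewrite IH ?ltn_subrL ?k0 ?(leq_trans k0) // dvdn_subl //.
  by rewrite (gtn_eqF (leq_trans k0 le_kn)) add0r addr0.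
rewrite big1 => [|i _]; last first.
  by rewrite ltn_eqF ?mul0r // (leq_trans (ltn_ord i)).
rewrite addr0; case: (posnP n) => [->|n0]; first by rewrite dvdn0.
by rewrite gtnNdvd // (gtn_eqF n0).
Qed.

(** Coefficients up to degree [n] of a product of series depend only on those
    of the factors, so that truncations can be multiplied as polynomials. *)
Lemma coef_prod_fps (R : comUnitRingType) n M (F : nat -> fps R)
    (p : nat -> {poly R}) :
  (forall k, (0 < k)%N -> forall i, (i <= n)%N -> F k i = (p k.-1)`_i) ->
  (\big[@fps_mul R/fps_one R]_(1 <= k < M.+1) F k) n = (\prod_(j < M) p j)`_n.
Proof.
move=> Fp; rewrite -(big_mkord xpredT p) -(big_add1 _ _ 0 M.+1 xpredT (p \o predn)).
rewrite big_nat_cond [in RHS]big_nat_cond.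
apply: (big_ind2 (fun (f : fps R) (q : {poly R}) =>
  forall i, (i <= n)%N -> f i = q`_i)) (leqnn n) => //.
- by move=> i _; rewrite coef1.
- move=> f1 q1 f2 q2 h1 h2 i le_in; rewrite /fps_mul coefM.
  apply: eq_bigr => j _; rewrite h1 ?h2 //.
    exact: leq_trans (leq_subr _ _) le_in.
  by apply: leq_trans le_in; rewrite -ltnS.
- by move=> k /andP[/andP[k0 _] _]; apply: Fp.
Qed.

(** A factor of index [j >= n] is 1 modulo ['X^(n.+1)]. *)
Lemma prod_geomX_stable (R : comNzRingType) n M : (n <= M)%N ->
  eq_upto n.+1 (\prod_(j < M) geomX R n j) (\prod_(j < n) geomX R n j).
Proof.
move=> le_nM; rewrite -!(big_mkord xpredT (geomX R n)) (big_cat_nat (n := n)) //=.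
rewrite -[X in eq_upto _ _ X]mulr1; apply: eq_upto_mul => //.
rewrite big_nat_cond; apply: (big_ind (fun q => eq_upto n.+1 q 1)) => //.
  by move=> p q p1 q1; rewrite -[X in eq_upto _ _ X](mulr1 1); apply: eq_upto_mul.
move=> j /andP[/andP[le_nj _] _] i le_in; rewrite coef_geomX // coef1.
case: (posnP i) => [->|i0]; first by rewrite dvdn0.
by rewrite gtnNdvd // (leq_trans le_in).
Qed.

Theorem theorem3p3 :
  [/\ fps_infprod (fun k : nat => fps_inv (fps_sub (fps_one rat) (fps_Xn rat k)))
        (fun n : nat => (npartitions n)%:R),
      npartitions 0 = 1%N
    & forall n : nat, (1 <= n)%N ->
        (npartitions n)%:R =
          \sum_(k in pi_tuples n)
            \prod_(j < n)
              (((k j)`!)%:R^-1 * ((sigma j.+1)%:R / (j.+1)%:R) ^+ k j) :> rat].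
Proof.
split.
- move=> n; exists n => M le_nM.
  rewrite (@coef_prod_fps _ n _ _ (geomX _ n)) => [|k k0 i le_in].
    by rewrite prod_geomX_stable // coef_prod_geomX.
  by rewrite fps_inv_geom // coef_geomX // prednK.
- by apply/eqP; rewrite -(eqr_nat rat) -coef_prod_geomX big_ord0 coef1.
move=> n _; rewrite -coef_prod_geomX -prod_expX_geomX //.
exact: (coef_prod_expX _ (fun j => (sigma j.+1)%:R / j.+1%:R)).
Qed.
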